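(* Let $m\ge 3$, $n\ge 3$, let $F_n(K_m)$ be a complete flower graph with set of associated vertices $I$, and let $u$ and $v$ be vertices of $F_n(K_m)$. Then $$r_{F_n(K_m)}(u,v)=\frac{2d(n-d)}{mn}\quad\text{if both } u,v\in I,$$ $$r_{F_n(K_m)}(u,v)=\frac{2d}{m}-\frac{(2d-1)^2}{2mn}\quad\text{if one of } u,v \text{ is in } I,$$ $$r_{F_n(K_m)}(u,v)=\frac{2d}{m}-\frac{2(d-1)^2}{mn}\quad\text{if neither } u \text{ nor } v \text{ is in } I,$$ where $d$ is the number of flower petals separating $u$ and $v$, including the petals containing $u$ and $v$.
   Context: For a connected graph $H$ with vertex set $\{1,\dots,N\}$ and Laplacian matrix $L$, the resistance distance between vertices $i,j$ is $r_H(i,j)=(e_i-e_j)^T L^\dagger (e_i-e_j)$, where $e_i$ is the $i$th standard unit vector and $L^\dagger$ is the Moore–Penrose pseudoinverse of $L$. Complete flower graph: for $m\ge3$ and $n\ge 3$, let $x,y$ be two arbitrary distinct vertices of the complete graph $K_m$. $F_n(K_m)$ is obtained from $n$ vertex-disjoint copies $G_1,\dots,G_n$ of $K_m$, with $x_i,y_i$ the copies of $x,y$ in $G_i$, by identifying $x_{i-1}$ with $y_i$ for $1<i\le n$ and $x_n$ with $y_1$. The copies $G_i$ are called the petals of the flower graph, and $I=\{x_1,\dots,x_n\}$ is the set of associated vertices, i.e. the vertices connecting the copies of $K_m$.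
   Formalization: In the third formula (neither u nor v in I) the vertices u and v are assumed distinct; for u = v not in I the resistance is 0 while the formula gives 2/m (d = 1) or −2/(mn) (d = 0), so the statement fails there. *)

(* Defs.v *)
From HB Require Import structures.
From mathcomp Require Import all_boot all_order all_algebra.

Set Implicit Arguments.
Unset Strict Implicit.
Unset Printing Implicit Defensive.

Import Order.TTheory GRing.Theory Num.Theory.
Local Open Scope ring_scope.
Local Open Scope quotient_scope.

Section MoorePenrose.

Variable R : realFieldType.

(* The four Penrose equations; the scalars are real, so the conjugate
   transpose is the transpose. *)
Definition is_moore_penrose (m n : nat) (A : 'M[R]_(m, n)) (P : 'M[R]_(n, m)) :=
  [&& A *m P *m A == A,
      P *m A *m P == P,
      (A *m P)^T == A *m P
    & (P *m A)^T == P *m A].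

Lemma gram_unit (r n : nat) (C : 'M[R]_(r, n)) :
  row_free C -> C *m C^T \in unitmx.
Proof.
move=> freeC; rewrite -row_free_unit; apply/inj_row_free => v vCC.
have vC0 : v *m C = 0.
  have : (v *m C) *m (v *m C)^T = 0.
    by rewrite trmx_mul mulmxA -(mulmxA v) vCC mul0mx.
  move=> /matrixP/(_ 0 0); rewrite mxE [RHS]mxE => s0.
  apply/matrixP=> i j; rewrite (ord1 i) [RHS]mxE.
  have ge0 k : true -> 0 <= (v *m C) 0 k * (v *m C)^T k 0.
    by move=> _; rewrite [_^T _ _]mxE -expr2 sqr_ge0.
  have /eqP := psumr_eq0P ge0 s0 (i := j) isT.
  by rewrite [_^T _ _]mxE mulf_eq0 orbb => /eqP.
by apply/eqP; rewrite -(mulmx_free_eq0 v freeC) vC0.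
Qed.

Lemma moore_penrose_exists (m n : nat) (A : 'M[R]_(m, n)) :
  exists P, is_moore_penrose A P.
Proof.
have := mulmx_base A; move: (col_base_full A) (row_base_free A).
move: (\rank A) (col_base A) (row_base A) => r B C fullB freeC <-.
have uC : C *m C^T \in unitmx by exact: gram_unit.
have uB : B^T *m B \in unitmx.
  rewrite -[X in _ *m X]trmxK; apply: gram_unit.
  by rewrite /row_free mxrank_tr.
pose GC := invmx (C *m C^T); pose GB := invmx (B^T *m B).
have CGC : C *m C^T *m GC = 1%:M by exact: mulmxV.
have GBB : GB *m B^T *m B = 1%:M by rewrite -mulmxA; exact: mulVmx.
pose P := C^T *m GC *m (GB *m B^T).
have AP : B *m C *m P = B *m (GB *m B^T).
  by rewrite /P -(mulmxA B) (mulmxA C) (mulmxA C) CGC mul1mx.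
have PA : P *m (B *m C) = C^T *m GC *m C.
  by rewrite /P -(mulmxA (C^T *m GC)) (mulmxA _ B) GBB mul1mx.
exists P; apply/and4P; split; apply/eqP.
- by rewrite AP -(mulmxA B) (mulmxA _ B) GBB mul1mx.
- by rewrite PA /P mulmxA -(mulmxA _ C) (mulmxA C) CGC mulmx1.
- by rewrite AP !trmx_mul trmxK trmx_inv trmx_mul trmxK mulmxA.
- by rewrite PA !trmx_mul trmxK trmx_inv trmx_mul trmxK mulmxA.
Qed.

Lemma moore_penrose_uniq (m n : nat) (A : 'M[R]_(m, n)) (P Q : 'M[R]_(n, m)) :
  is_moore_penrose A P -> is_moore_penrose A Q -> P = Q.
Proof.
move=> /and4P[/eqP p1 /eqP p2 /eqP p3 /eqP p4].
move=> /and4P[/eqP q1 /eqP q2 /eqP q3 /eqP q4].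
have e1 : A *m P = A *m Q.
  rewrite -p3 -[in LHS]q1 -(mulmxA (A *m Q) A P) trmx_mul p3 q3.
  by rewrite mulmxA p1.
have e2 : P *m A = Q *m A.
  rewrite -p4 -[in LHS]q1 -(mulmxA A Q A) mulmxA trmx_mul p4 q4.
  by rewrite -mulmxA (mulmxA A P A) p1.
by rewrite -p2 e2 -mulmxA e1 mulmxA q2.
Qed.

Definition moore_penrose (m n : nat) (A : 'M[R]_(m, n)) : 'M[R]_(n, m) :=
  xchoose (moore_penrose_exists A).

Lemma moore_penroseP (m n : nat) (A : 'M[R]_(m, n)) :
  is_moore_penrose A (moore_penrose A).
Proof. exact: xchooseP (moore_penrose_exists A). Qed.

End MoorePenrose.

(* Matrices are indexed by 'I_#|V|, through enum_val / enum_rank. *)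
Section Resistance.

Variables (R : realFieldType) (V : finType) (e : rel V).

Definition laplacian : 'M[R]_#|V| :=
  \matrix_(i, j) (#|e (enum_val i)|%:R *+ (i == j)
                  - (e (enum_val i) (enum_val j))%:R).

Definition std_vec (u : V) : 'cV[R]_#|V| := delta_mx (enum_rank u) 0.

Definition resistance (u v : V) : R :=
  ((std_vec u - std_vec v)^T *m moore_penrose laplacian
     *m (std_vec u - std_vec v)) 0 0.

End Resistance.

(* The pair (i, a) is the copy in petal i of the vertex a of K_m; petals are
   indexed cyclically by 'I_n, with ordS i the petal following i. *)
Section Flower.

Variables (n m : nat) (x y : 'I_m).

Definition glue_step : rel ('I_n * 'I_m) := fun p q =>
  [&& p.2 == x, q.2 == y & q.1 == ordS p.1].

Definition glue : rel ('I_n * 'I_m) :=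
  connect (fun p q => glue_step p q || glue_step q p).

Lemma glue_refl : reflexive glue. Proof. exact: connect0. Qed.

Lemma glue_sym : symmetric glue.
Proof. by apply: sym_connect_sym => p q; rewrite orbC. Qed.

Lemma glue_trans : transitive glue. Proof. exact: connect_trans. Qed.

Canonical glue_equiv := EquivRel glue glue_refl glue_sym glue_trans.

Definition flower := {eq_quot glue_equiv}.

HB.instance Definition _ := [Finite of flower by <:%/].
HB.instance Definition _ := EqQuotient.on flower.

Definition petal_vertex (i : 'I_n) (a : 'I_m) : flower := \pi_flower (i, a).

Definition flower_adj : rel flower := fun u v =>
  [exists i : 'I_n, exists a : 'I_m, exists b : 'I_m,
    [&& a != b, u == petal_vertex i a & v == petal_vertex i b]].

Definition associated : {set flower} := [set petal_vertex i x | i : 'I_n].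

(* Going around the flower in the direction of increasing indices, the d
   consecutive petals i, i+1, ..., i+d-1 lead from u to v.  Each petal is
   entered at its copy of y and left at its copy of x, so a != x and b != y
   say that the first and the last petal really are needed: an associated
   vertex u (resp. v) counts for the petal following (resp. preceding) it. *)
Definition forward_petals (d : nat) (u v : flower) : Prop :=
  (0 < d <= n)%N /\
  exists (i : 'I_n) (a b : 'I_m),
    [/\ a != x, b != y, u = petal_vertex i a
      & v = petal_vertex (iter d.-1 (@ordS n) i) b].

(* d is the number of petals separating u and v, including those containing
   u and v.  The petals can be counted either way around the flower, hence in
   general two values of d; no petal separates a vertex from itself. *)
Definition petals_separating (d : nat) (u v : flower) : Prop :=
  [\/ d = 0%N /\ u = v, forward_petals d u v | forward_petals d v u].

Lemma petal_vertex_glue (i : 'I_n) :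
  petal_vertex i x = petal_vertex (ordS i) y.
Proof. by apply/eqmodP/connect1; rewrite /glue_step /= !eqxx. Qed.

(* The quotient identifies nothing more than x_{i-1} with y_i. *)
Lemma petal_vertexP (i j : 'I_n) (a b : 'I_m) : x != y ->
  petal_vertex i a = petal_vertex j b <->
  [|| (i, a) == (j, b), glue_step (i, a) (j, b) | glue_step (j, b) (i, a)].
Proof.
move=> xy.
pose g : rel ('I_n * 'I_m) := fun p q =>
  [|| p == q, glue_step p q | glue_step q p].
have gtr : transitive g.
  have yx : (y == x) = false by rewrite eq_sym (negbTE xy).
  move=> q p r /or3P[/eqP -> //||] pq /or3P[/eqP <-||].
  - by rewrite /g pq orbT.
  - by case/and3P: pq => _ /eqP qy _ /and3P[]; rewrite qy yx.
  - case/and3P: pq => /eqP px _ /eqP q1 /and3P[/eqP rx _].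
    rewrite q1 => /eqP/(can_inj (@ordSK n)) pr.
    by rewrite /g [p]surjective_pairing [r]surjective_pairing px rx pr eqxx.
  - by rewrite /g pq !orbT.
  - case/and3P: pq => _ /eqP py /eqP p1 /and3P[_ /eqP ry /eqP r1].
    by rewrite /g [p]surjective_pairing [r]surjective_pairing py ry p1 r1 eqxx.
  by case/and3P: pq => /eqP qx _ _ /and3P[_]; rewrite qx (negbTE xy).
split=> [/eqmodP|/predU1P[[-> ->]//|h]]; last by apply/eqmodP/connect1.
case/connectP=> p; elim: p (i, a) => [|q p IH] r /= => [_ ->|].
  by rewrite eqxx.
by case/andP=> rq qp lastp; apply: gtr (IH q qp lastp); rewrite /g rq orbT.
Qed.

Lemma iter_ordS (k : nat) (i : 'I_n) :
  iter k (@ordS n) i = ((i + k) %% n)%N :> nat.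
Proof.
elim: k => [|k IHk] /=; first by rewrite addn0 modn_small.
by rewrite IHk -addn1 modnDml addn1 addnS.
Qed.

Lemma petals_separating_exists (u v : flower) :
  x != y -> exists d, petals_separating d u v.
Proof.
move=> xy.
have [i [a [ax ->]]] : exists i a, a != x /\ u = petal_vertex i a.
  elim/quotW: u => -[i a]; have [->|ax] := eqVneq a x; last by exists i, a.
  by exists (ordS i), y; rewrite eq_sym -petal_vertex_glue.
have [j [b [by_ ->]]] : exists j b, b != y /\ v = petal_vertex j b.
  elim/quotW: v => -[j b]; have [->|b_y] := eqVneq b y; last by exists j, b.
  exists (ord_pred j), x; split=> //.
  by rewrite petal_vertex_glue ord_predK.
have n_gt0 : (0 < n)%N by apply: leq_ltn_trans (ltn_ord i).
exists ((j + (n - i)) %% n).+1; apply: Or32; split; first by rewrite /= ltn_pmod.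
exists i, a, b; split=> //; congr petal_vertex; apply: val_inj.
rewrite /= iter_ordS modnDmr addnCA subnKC; last exact: ltnW.
by rewrite modnDr modn_small.
Qed.

End Flower.

(* Main.v *)
(* Resistances are differences of potentials: if [L f = e_u - e_v] then
   [r(u, v) = f u - f v].  Petals meet in at most one vertex, so the Laplacian
   of the flower is the sum of those of its petals, and in a copy of [K_m] a
   current [c] with zero total is produced by the potential [c / m], up to an
   additive constant for each petal.  Sending a unit current from [u] to [v],
   with [t + 1] of it going forward through the petals between [u] and [v] and
   [- t] going backward through the others, the constants can be chosen so that
   the potentials agree at the associated vertices for exactly one value of
   [t]. *)
Require Import Defs.
From mathcomp Require Import all_boot all_order all_algebra.
From mathcomp Require Import ring lra zify.

Import Order.TTheory GRing.Theory Num.Theory.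
Local Open Scope ring_scope.

(** * Resistance as a potential difference *)

Lemma sum_delta (R : pzRingType) (T : finType) (h : T -> R) (t : T) :
  \sum_s h s * (s == t)%:R = h t.
Proof.
rewrite (bigD1 t) //= eqxx mulr1 big1 ?addr0 // => s /negbTE->.
by rewrite mulr0.
Qed.

Lemma resistance_sym (R : realFieldType) (V : finType) (e : rel V) (u v : V) :
  resistance R e u v = resistance R e v u.
Proof.
rewrite /resistance -[std_vec R u - _]opprB.
by rewrite [(- _)^T]linearN /= mulNmx mulmxN mulNmx opprK.
Qed.

(** As [e_u - e_v = L f] and [L] is symmetric, the resistance is [f^T] times [L], its pseudoinverse,
    [L] and [f]; the first Penrose equation reduces this to [f^T L f]. *)
Lemma resistance_potential (R : realFieldType) (V : finType) (e : rel V)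
    (f : V -> R) (u v : V) :
  symmetric e ->
  (forall w, \sum_(z | e w z) (f w - f z) = (w == u)%:R - (w == v)%:R) ->
  resistance R e u v = f u - f v.
Proof.
move=> esym fP; pose F : 'cV[R]_#|V| := \col_i f (enum_val i).
set L := laplacian R e.
have LT : L^T = L.
  apply/matrixP=> i j; rewrite !mxE eq_sym esym; congr (_ - _).
  by have [->|] := eqVneq j i.
have sum_val h : \sum_(i < #|V|) h (enum_val i) = \sum_z h z :> R.
  by rewrite -big_enum_val.
have std_vecE w i : std_vec R w i 0 = (enum_val i == w)%:R.
  rewrite mxE eqxx andbT; congr (nat_of_bool _)%:R.
  by apply/eqP/eqP => [->|<-]; rewrite ?enum_rankK ?enum_valK.
have LF : L *m F = std_vec R u - std_vec R v.
  apply/matrixP=> i j; rewrite (ord1 j) [LHS]mxE [RHS]mxE [X in _ + X]mxE.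
  rewrite !std_vecE.
  rewrite -fP sumrB sumr_const (big_mkcond (e (enum_val i))) /=.
  rewrite -[X in _ = _ - X]sum_val.
  under eq_bigr => k _ do rewrite !mxE mulrBl.
  rewrite sumrB; congr (_ - _).
    rewrite (bigD1 i) //= eqxx mulr1n mulr_natl big1 ?addr0 // => k ik.
    by rewrite eq_sym (negbTE ik) mulr0n mul0r.
  by apply: eq_bigr => k _; case: (e _ _); rewrite ?mul1r ?mul0r.
have /and4P[/eqP LPL _ _ _] := moore_penroseP L.
rewrite /resistance -/L -LF trmx_mul LT -!mulmxA (mulmxA L) (mulmxA _ L) LPL LF.
have std_vecF w : (F^T *m std_vec R w) 0 0 = f w.
  rewrite -(sum_delta _ _ f) -sum_val mxE.
  by apply: eq_bigr => k _; rewrite std_vecE !mxE.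
by rewrite mulmxBr mxE [X in _ + X]mxE !std_vecF.
Qed.

Lemma flower_adj_sym (n m : nat) (x y : 'I_m) :
  symmetric (@flower_adj n m x y).
Proof.
suff adjW u v : flower_adj u v -> @flower_adj n m x y v u.
  by move=> u v; apply/idP/idP; apply: adjW.
case/existsP=> i /existsP[a /existsP[b /and3P[ab ua vb]]].
apply/existsP; exists i; apply/existsP; exists b; apply/existsP; exists a.
by rewrite eq_sym ab ua vb.
Qed.

Lemma ordS_neq (n : nat) (i : 'I_n) : (1 < n)%N -> ordS i != i.
Proof.
move=> n1; apply/eqP => /(congr1 val) /= e.
have := ltn_ord i; rewrite leq_eqVlt => /predU1P[eq_n|lt_n].
  by move: e; rewrite eq_n modnn => e; rewrite -e in eq_n; rewrite -eq_n in n1.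
move: e; rewrite modn_small // => /eqP.
by rewrite -[X in _ == X]addn0 -addn1 eqn_add2l.
Qed.

Lemma ordS2_neq (n : nat) (i : 'I_n) : (2 < n)%N -> ordS (ordS i) != i.
Proof.
move=> n2; apply/eqP => /(congr1 (@nat_of_ord n)).
rewrite -[ordS (ordS i)]/(iter 2 (@ordS n) i) iter_ordS => /eqP.
have iE := modn_small (ltn_ord i).
rewrite -[X in _ == X]iE -[X in _ == (X %% _)%N]addn0 eqn_modDl.
by rewrite mod0n modn_small.
Qed.

(** * Petals counted forward from a fixed one *)

Section CyclicDistance.

Variables (n : nat) (i0 : 'I_n).

(* [i - i0] modulo [n]; the subtraction [n - i0] never truncates. *)
Definition ordS_dist (i : 'I_n) : nat := ((i + (n - i0)) %% n)%N.

Lemma ordS_dist_lt i : (ordS_dist i < n)%N.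
Proof. by rewrite ltn_pmod // (leq_ltn_trans _ (ltn_ord i0)). Qed.

Lemma ordS_dist_iter k : (k < n)%N -> ordS_dist (iter k (@ordS n) i0) = k.
Proof.
move=> kn; rewrite /ordS_dist iter_ordS modnDml -addnA addnCA subnKC 1?ltnW //.
by rewrite modnDr modn_small.
Qed.

Lemma iter_ordS_dist i : iter (ordS_dist i) (@ordS n) i0 = i.
Proof.
apply: val_inj; rewrite /= iter_ordS modnDmr addnCA subnKC 1?ltnW //.
by rewrite modnDr modn_small.
Qed.

Lemma ordS_dist_ordS i :
  ordS_dist (ordS i) = if (ordS_dist i).+1 == n then 0%N else (ordS_dist i).+1.
Proof.
rewrite -{1}[i]iter_ordS_dist -iterS; case: eqP => [->|/eqP neq_n].
  have -> : iter n (@ordS n) i0 = i0.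
    by apply: val_inj; rewrite /= iter_ordS modnDr modn_small.
  by apply: (ordS_dist_iter 0); rewrite (leq_ltn_trans _ (ltn_ord i0)).
by rewrite ordS_dist_iter // ltn_neqAle neq_n ordS_dist_lt.
Qed.

Lemma ordS_dist_eq i k : (k < n)%N ->
  (ordS_dist i == k) = (i == iter k (@ordS n) i0).
Proof.
by move=> kn; apply/eqP/eqP => [<-|->]; rewrite ?iter_ordS_dist ?ordS_dist_iter.
Qed.

Lemma sum_ordS_dist_eq (R : pzRingType) k (g : 'I_n -> R) : (k < n)%N ->
  \sum_i (ordS_dist i == k)%:R * g i = g (iter k (@ordS n) i0).
Proof.
move=> kn; rewrite -[RHS](sum_delta _ _ g); apply: eq_bigr => i _.
by rewrite ordS_dist_eq //; case: eqP => _; rewrite ?mul1r ?mulr1 ?mul0r ?mulr0.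
Qed.

(** The differences telescope along the [d] petals starting at [i0]; for [d = n] both sides
    vanish. *)
Lemma sum_ordS_dist_lt (R : pzRingType) (d : nat) (g : 'I_n -> R) :
  (d <= n)%N ->
  \sum_i (ordS_dist i < d)%N%:R * (g i - g (ordS i))
  = g i0 - g (iter d (@ordS n) i0).
Proof.
move=> dn.
have iter_inj : injective (fun k : 'I_n => iter k (@ordS n) i0).
  by move=> j k /(congr1 ordS_dist); rewrite !ordS_dist_iter // => /val_inj.
rewrite (reindex_inj iter_inj) /=.
under eq_bigr => k _ do rewrite ordS_dist_iter // -iterS mulr_natl mulrb.
rewrite -big_mkcond.
pose u k := g (iter k (@ordS n) i0).
rewrite -(big_ord_widen _ (fun k => u k - u k.+1) dn).
rewrite -(big_mkord xpredT (fun k => u k - u k.+1)).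
under eq_bigr => k _ do rewrite -opprB.
by rewrite sumrN telescope_sumr // opprB.
Qed.

End CyclicDistance.

(** * Edges and potentials of the flower *)

Lemma associatedE (n m : nat) (x y : 'I_m) (i : 'I_n) (a : 'I_m) : x != y ->
  (petal_vertex x y i a \in associated n x y) = (a == x) || (a == y).
Proof.
move=> xy; apply/imsetP/orP => [[j _ /(petal_vertexP _ _ _ _ xy)]|].
  rewrite /glue_step /= xpair_eqE.
  by case/or3P => [/andP[_]|/and3P[]|/and3P[]]; auto.
case=> /eqP->; first by exists i.
by exists (ord_pred i); rewrite // petal_vertex_glue ord_predK.
Qed.

Section Flower.

Variables (n m : nat) (x y : 'I_m).
Hypotheses (n_ge3 : (2 < n)%N) (xy : x != y).

Local Notation pv := (petal_vertex x y).
Local Notation flow := (flower n x y).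

(** Distinct petals meet in at most one vertex: otherwise [ordS] or its square would fix a petal.
    This is where [n >= 3] matters, as two petals would share both associated vertices. *)
Lemma petal_edge_inj (i j : 'I_n) (a b c d : 'I_m) : a != b ->  c != d ->
  pv i a = pv j c -> pv i b = pv j d -> [/\ i = j, a = c & b = d].
Proof.
move=> ab cd /(petal_vertexP _ _ _ _ xy) e1 /(petal_vertexP _ _ _ _ xy) e2.
have S1 k : ordS k != k :> 'I_n by apply: ordS_neq; apply: ltnW.
have S2 k : ordS (ordS k) != k :> 'I_n by apply: ordS2_neq.
move: e1 e2; rewrite /glue_step /= !xpair_eqE.
case/or3P=> [/andP[/eqP<- /eqP<-]|/and3P[/eqP ax /eqP cy /eqP->]|
             /and3P[/eqP cx /eqP ay /eqP->]].
- by rewrite ![i == ordS i]eq_sym !(negbTE (S1 i)) !andbF !orbF eqxx => /eqP.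
- rewrite eqxx [i == ordS i]eq_sym (negbTE (S1 i)) [i == _]eq_sym.
  rewrite (negbTE (S2 i)) !andbF !andbT orbF /= => /andP[/eqP bx _].
  by rewrite ax bx eqxx in ab.
rewrite eqxx (negbTE (S1 j)) [j == _]eq_sym (negbTE (S2 j)) !andbF !andbT /=.
by case/andP=> /eqP dx _; rewrite cx dx eqxx in cd.
Qed.

(** Each edge lies in a single petal, so the sum splits over the copies of [w], two of them when [w]
    is associated. *)
Lemma sum_flower_adj (R : realFieldType) (w : flow) (g : flow -> R) :
  \sum_(z | flower_adj w z) g z =
  \sum_(p | pv p.1 p.2 == w) \sum_(b | p.2 != b) g (pv p.1 b).
Proof.
rewrite pair_big_dep /=.
pose S := [set q : 'I_n * 'I_m * 'I_m |
  (pv q.1.1 q.1.2 == w) && (q.1.2 != q.2)].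
pose h (q : 'I_n * 'I_m * 'I_m) := pv q.1.1 q.2.
have h_inj : {in S &, injective h}.
  move=> [[i a] b] [[j c] d]; rewrite !inE /h /= => /andP[/eqP e1 ab].
  case/andP=> /eqP e2 cd e3; have e : pv i a = pv j c by rewrite e1 e2.
  by case: (petal_edge_inj _ _ _ _ _ _ ab cd e e3) => -> -> ->.
transitivity (\sum_(q in S) g (h q)); last by apply: eq_bigl => q; rewrite inE.
rewrite -(big_imset g h_inj); apply: eq_bigl => z; apply/idP/imsetP.
  case/existsP=> i /existsP[a /existsP[b /and3P[ab /eqP wE /eqP zE]]].
  by exists (i, a, b); rewrite // inE /= wE eqxx.
case=> -[[i a] b]; rewrite inE /= => /andP[/eqP wE ab] ->.
apply/existsP; exists i; apply/existsP; exists a; apply/existsP; exists b.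
by rewrite ab -wE /h !eqxx.
Qed.

(** Since [c i] has zero total, the differences [(c i a - c i b) / m] sum over [b] to [c i a]. The
    second hypothesis makes consecutive petals agree at their common vertex, where the currents of
    both copies add up. *)
Lemma flower_potential (R : realFieldType)
    (c : 'I_n -> 'I_m -> R) (mu : 'I_n -> R) :
  (forall i, \sum_a c i a = 0) ->
  (forall i, c i x + mu i = c (ordS i) y + mu (ordS i)) ->
  exists2 f : flow -> R,
    forall i a, f (pv i a) = (c i a + mu i) / m%:R &
    forall w, \sum_(z | flower_adj w z) (f w - f z)
              = \sum_i \sum_a (pv i a == w)%:R * c i a.
Proof.
move=> c0 glued; pose F (p : 'I_n * 'I_m) := (c p.1 p.2 + mu p.1) / m%:R.
have m_neq0 : m%:R != 0 :> R.
  by rewrite pnatr_eq0 -lt0n (leq_ltn_trans _ (ltn_ord x)).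
pose f (w : flow) := F (repr w).
have fE i a : f (pv i a) = (c i a + mu i) / m%:R.
  have : pv (repr (pv i a)).1 (repr (pv i a)).2 = pv i a.
    by rewrite /petal_vertex -surjective_pairing reprK.
  rewrite /f; case: (repr _) => j b /= /(petal_vertexP _ _ _ _ xy).
  rewrite /glue_step /F /= => /or3P[/eqP[-> ->]|/and3P[]|/and3P[]] //.
    by move=> /eqP-> /eqP-> /eqP->; rewrite glued.
  by move=> /eqP-> /eqP-> /eqP->; rewrite glued.
exists f => // w.
rewrite sum_flower_adj [RHS]pair_big big_mkcond; apply: eq_bigr => -[i a] _ /=.
case: eqP => [<-|_]; last by rewrite mul0r.
rewrite mul1r.
transitivity (\sum_b (f (pv i a) - f (pv i b))).
  rewrite [RHS](bigD1 a) //= subrr add0r.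
  by apply: eq_bigl => b; rewrite eq_sym.
under eq_bigr => b _ do rewrite !fE -mulrBl opprD addrACA subrr addr0.
rewrite -mulr_suml sumrB c0 subr0 sumr_const card_ord.
by rewrite -(mulr_natr (c i a)) mulfK.
Qed.

(** A unit current confined to the [d] petals dissipates [2 / m] in each, and its potential drops
    add up to the bracket over [m]. Cancelling them by a circulation around the flower, a cycle of
    resistance [2 n / m], saves the second term. The indicators tell which ends are associated, so
    one formula covers all cases. *)
Lemma resistance_forward (R : realFieldType) (d : nat) (i0 : 'I_n)
    (a0 b0 : 'I_m) :
  (0 < d <= n)%N -> a0 != x -> b0 != y -> (d != 1%N) || (a0 != b0) ->
  resistance R (@flower_adj n m x y) (pv i0 a0) (pv (iter d.-1 (@ordS n) i0) b0)
  = 2 * d%:R / m%:R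
    - (2 * (d%:R - 1) + (a0 == y)%:R + (b0 == x)%:R) ^+ 2 / (2 * m%:R * n%:R).
Proof.
move=> /andP[d_gt0 d_le] a0x b0y ab0.
set al : R := (a0 == y)%:R; set be : R := (b0 == x)%:R.
have n_neq0 : n%:R != 0 :> R by rewrite pnatr_eq0; case: (n) n_ge3.
have m_neq0 : m%:R != 0 :> R.
  by rewrite pnatr_eq0 -lt0n (leq_ltn_trans _ (ltn_ord x)).
(* This value makes the potential single-valued around the flower. *)
pose t : R := - (2 * (d%:R - 1) + al + be) / (2 * n%:R).
have tE : 2 * n%:R * t = - (2 * (d%:R - 1) + al + be) by rewrite /t; field.
(* The current entering petal [i0 + k] at its copy of [a]: [t + 1] from [y] to
   [x] if [k < d] and [t] otherwise, except that the unit current starts at [a0]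
   instead of [y] in the first petal and ends at [b0] instead of [x] in the
   petal [k = d - 1]. *)
pose c (k : nat) (a : 'I_m) : R :=
  (k == 0)%N%:R * ((a == a0)%:R - (a == y)%:R)
  + (k < d)%N%:R * ((a == y)%:R - (a == x)%:R)
  + (k == d.-1)%N%:R * ((a == x)%:R - (a == b0)%:R)
  + t * ((a == y)%:R - (a == x)%:R).
(* The gluing conditions solved from [mu 0 = 0]: [mu] falls by [2 (t + 1)] between forward petals,
   by [2 t + be] on leaving the last of them, and by [2 t] afterwards. *)
pose mu (k : nat) : R :=
  - 2 * t * k%:R - (if (k < d)%N then 2 * k%:R else 2 * (d%:R - 1) + be).
set j0 := iter d.-1 _ i0.
(* Taking [h = 1] gives the zero total; taking for [h] the indicator of a vertex gives the current
   entering there. *)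
have sum_c (h : 'I_m -> R) k : \sum_a h a * c k a =
    (k == 0)%N%:R * (h a0 - h y) + (k < d)%N%:R * (h y - h x)
    + (k == d.-1)%N%:R * (h x - h b0) + t * (h y - h x).
  rewrite -(sum_delta _ _ h a0) -(sum_delta _ _ h b0).
  rewrite -(sum_delta _ _ h x) -(sum_delta _ _ h y).
  rewrite -!sumrB !mulr_sumr -!big_split /=; apply: eq_bigr => a _.
  by rewrite /c; ring.
pose dist := ordS_dist n i0.
have [i||f fE fL] := @flower_potential R
  (fun i => c (dist i)) (fun i => mu (dist i)).
- by have := sum_c (fun=> 1) (dist i); rewrite -mulr_sumr mul1r => ->; ring.
- move=> i; rewrite /dist ordS_dist_ordS; have := ordS_dist_lt n i0 i.
  move: (ordS_dist n i0 i) => k k_lt.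
  rewrite /c /mu !eqxx (negbTE xy) [y == x]eq_sym (negbTE xy).
  rewrite [x == a0]eq_sym (negbTE a0x) [y == b0]eq_sym (negbTE b0y).
  rewrite [y == a0]eq_sym [x == b0]eq_sym -/al -/be.
  have dE : d%:R = d.-1%:R + 1 :> R by rewrite natr1 prednK.
  have kS : k.+1%:R = k%:R + 1 :> R by rewrite natr1.
  rewrite !mulr1n !mulr0n subrr !mulr0 !addr0 add0r.
  (* Only the return from the last petal to [i0] constrains [t]; the other gluings hold for every
     [t]. *)
  have [nE|k1n] := eqVneq k.+1 n.
    rewrite d_gt0 eqxx.
    have nS : n%:R = k%:R + 1 :> R by rewrite -kS nE.
    rewrite nS in tE.
    case: ltnP => kd; have [E|E] := eqVneq k d.-1; try lia.
      by rewrite dE -E in tE *; rewrite !mulr1n; lra.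
    by rewrite !mulr1n !mulr0n; lra.
  have [k1d|k1d|k1d] := ltngtP k.+1 d.
  - have -> : (k == d.-1) = false by lia.
    by rewrite kS !mulr1n !mulr0n; ring.
  - have -> : (k == d.-1) = false by lia.
    by rewrite kS !mulr0n; ring.
  - have -> : (k == d.-1) by lia.
    by rewrite -k1d kS !mulr1n !mulr0n; ring.
have /resistance_potential -> : forall w,
    \sum_(z | flower_adj w z) (f w - f z)
    = (w == pv i0 a0)%:R - (w == pv j0 b0)%:R.
- move=> w; rewrite fL; pose h i a : R := (pv i a == w)%:R.
  (* With every exit rewritten as the next entrance, the circulation sums to zero and the unit
     current telescopes. *)
  have hx i : h i x = h (ordS i) y by rewrite /h petal_vertex_glue.
  under eq_bigr => i _ do rewrite (sum_c (h i)) hx /dist.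
  rewrite !big_split /= (sum_ordS_dist_lt _ _ _ _ (h ^~ y)) //.
  have -> : \sum_i t * (h i y - h (ordS i) y) = 0.
    rewrite -mulr_sumr sumrB [X in X - _](reindex_inj (@ordS_inj n)).
    by rewrite subrr mulr0.
  rewrite addr0.
  rewrite !sum_ordS_dist_eq /=; try lia.
  rewrite -iterS prednK // /h ![pv _ _ == w]eq_sym; ring.
- have d0 : dist i0 = 0%N.
    by apply: (ordS_dist_iter n i0 0); lia.
  have d1 : dist j0 = d.-1 by apply: ordS_dist_iter; lia.
  have dE : d.-1%:R = d%:R - 1 :> R by rewrite -{2}(prednK d_gt0) -natr1 addrK.
  rewrite !fE d0 d1 /c /mu /= d_gt0.
  have -> : (d.-1 < d)%N by lia.
  rewrite !eqxx (negbTE a0x) (negbTE b0y) -/al -/be [b0 == a0]eq_sym.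
  (* The start and end corrections share a petal only when [d = 1], and then [a0 != b0]. *)
  have d1a0 : (d.-1 == 0)%N%:R * (a0 == b0)%:R = 0 :> R.
    have [dm1|] := eqVneq d.-1 0%N; last by rewrite mul0r.
    by move: ab0; rewrite -(prednK d_gt0) dm1 /= => /negbTE->; rewrite mulr0.
  rewrite dE [0%N == _]eq_sym !mulr0n !mulr1n !subr0 sub0r mulrN d1a0 /t.
  by field; apply/andP.
exact: flower_adj_sym.
Qed.

End Flower.

(** * The three formulas, by membership of the ends in [I] *)

Theorem theorem4p3 (R : realFieldType) (m n : nat) (x y : 'I_m)
    (hm : (3 <= m)%N) (hn : (3 <= n)%N) (hxy : x != y)
    (u v : flower n x y) (d : nat) (hd : petals_separating d u v) :
  [/\ (u \in associated n x y) && (v \in associated n x y) ->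
        resistance R (@flower_adj n m x y) u v
          = (2 * d%:R * (n%:R - d%:R)) / (m%:R * n%:R),
      (u \in associated n x y) (+) (v \in associated n x y) ->
        resistance R (@flower_adj n m x y) u v
          = (2 * d%:R) / m%:R - (2 * d%:R - 1) ^+ 2 / (2 * m%:R * n%:R)
    & (u \notin associated n x y) && (v \notin associated n x y) -> u != v ->
        resistance R (@flower_adj n m x y) u v
          = (2 * d%:R) / m%:R - (2 * (d%:R - 1) ^+ 2) / (m%:R * n%:R)].
Proof.
have n_neq0 : n%:R != 0 :> R by rewrite pnatr_eq0; case: (n) hn.
have m_neq0 : m%:R != 0 :> R by rewrite pnatr_eq0; case: (m) hm.
wlog fwd : u v hd / d = 0%N /\ u = v \/ forward_petals d u v => [hwlog|].
  case: (hd) => [duv|fwd|fwd]; [by apply: hwlog => //; left | |].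
    by apply: hwlog => //; right.
  have := hwlog v u (Or32 _ _ fwd) (or_intror fwd).
  by rewrite andbC addbC [~~ _ && _]andbC [v == u]eq_sym resistance_sym.
case: fwd => [[-> <-]|[d_n [i [a [b [ax b_y uE vE]]]]]].
  (* For [d = 0] the first formula gives 0, and [u = v] rules out the other two cases. *)
  split; [move=> _ | by rewrite addbb | by rewrite eqxx].
  by rewrite /resistance subrr mulmx0 mxE mulr0 !mul0r.
have assoc_u : (u \in associated n x y) = (a == y).
  by rewrite uE associatedE // (negbTE ax).
have assoc_v : (v \in associated n x y) = (b == x).
  by rewrite vE associatedE // (negbTE b_y) orbF.
(* The condition fails only if [u = v] with [a = b] neither [x] nor [y]; this concerns the third
   case alone, where [u != v]. *)
have res : (d != 1%N) || (a != b) -> resistance R (@flower_adj n m x y) u v =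
    2 * d%:R / m%:R - (2 * (d%:R - 1) + (a == y)%:R + (b == x)%:R) ^+ 2
                      / (2 * m%:R * n%:R).
  by rewrite uE vE; apply: resistance_forward.
rewrite assoc_u assoc_v; split.
- move=> /andP[ay bx]; rewrite res; last first.
    by rewrite (eqP ay) (eqP bx) [y == x]eq_sym hxy orbT.
  by rewrite ay bx ?mulr1n ?mulr0n; field; apply/andP.
- move=> axb; rewrite res; last first.
    apply/orP; right; apply: contraTneq axb => ab.
    by rewrite -ab (negbTE ax) ab (negbTE b_y).
  by case: (a == y) (b == x) axb => -[] //= _;
    rewrite ?mulr1n ?mulr0n; field; apply/andP.
- move=> /andP[/negbTE ay /negbTE bx] uv; rewrite res; last first.
    apply: contraNT uv; rewrite negb_or !negbK uE vE.
    by case/andP=> /eqP-> /eqP->.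
  by rewrite ay bx ?mulr1n ?mulr0n; field; apply/andP.
Qed.
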